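(* Let $G$ be a $3$-connected cubic graph whose canonical decomposition into cyclically $4$-edge-connected cubic graphs contains at most one cyclically odd factor. Then $G$ admits a coherent decycling partition, i.e. a partition $\{A,J\}$ of $V(G)$ such that $G[A]$ is a tree and $J$ is independent or near-independent.
   Context: A cubic graph is $3$-regular; $3$-connected cubic graphs are simple. $\beta(H)=|E(H)|-|V(H)|+1$ for connected $H$; $H$ is cyclically odd if $\beta(H)$ is odd. A set $B\subseteq E(G)$ is cycle-separating if $G-B$ is disconnected with at least two components containing cycles; a connected graph is cyclically $4$-edge-connected if no set of fewer than $4$ edges is cycle-separating. $3$-sum of bridgeless cubic graphs $G_1,G_2$ at root vertices $v_1,v_2$: delete $v_1,v_2$, keep the three dangling edge-ends at each, and identify the dangling edges of $G_1-v_1$ bijectively with those of $G_2-v_2$. Canonical decomposition: if $G$ has a $3$-edge-cut leaving two components $H_1,H_2$ each with more than one vertex, form $\bar H_i$ by attaching the three dangling edges of $H_i$ to a new vertex, so $G$ is a $3$-sum of $\bar H_1,\bar H_2$; repeating on pieces until none has such a cut yields a collection $\{G_1,\dots,G_r\}$ of cyclically $4$-edge-connected cubic graphs (the factors), unique up to isomorphism and order. $G[A]$ denotes the induced subgraph; $J$ is independent if $G[J]$ has no edge and near-independent if $G[J]$ has exactly one edge. *)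

(* Defs.v *)
From mathcomp Require Import all_boot.
Set Implicit Arguments. Unset Strict Implicit. Unset Printing Implicit Defensive.

Section GraphDefs.
Variables (V : finType) (adj : rel V).

Definition edges : {set {set V}} :=
  [set e : {set V} | [exists x, exists y, adj x y && (e == [set x; y])]].

Definition induced_edges (A : {set V}) : {set {set V}} :=
  [set e in edges | e \subset A].

Definition connected_in (A : {set V}) : Prop :=
  A != set0 /\
  forall x y, x \in A -> y \in A ->
    connect [rel u v | [&& adj u v, u \in A & v \in A]] x y.

Definition acyclic_in (A : {set V}) : Prop :=
  forall s : seq V, uniq s -> 3 <= size s -> {subset s <= A} -> ~~ cycle adj s.

Definition tree_in (A : {set V}) : Prop := connected_in A /\ acyclic_in A.

Definition independent (J : {set V}) : Prop := induced_edges J = set0.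
Definition near_independent (J : {set V}) : Prop := #|induced_edges J| = 1.

Definition coherent_decycling_partition (A : {set V}) : Prop :=
  tree_in A /\ (independent (~: A) \/ near_independent (~: A)).

Definition cubic : Prop := forall x : V, #|[set y | adj x y]| = 3.

Definition three_connected : Prop :=
  3 < #|V| /\ forall X : {set V}, #|X| < 3 -> connected_in (~: X).

Definition cut_edges (S : {set V}) : {set {set V}} :=
  [set e : {set V} | [exists x, exists y,
     [&& adj x y, x \in S, y \notin S & e == [set x; y]]]].

(* S, ~S determine a 3-edge-cut leaving exactly two components G[S], G[~S],
   each with more than one vertex; moreover the three cut edges have pairwise
   distinct end-vertices (automatic in the 3-connected setting), so that the
   pieces obtained by adding a new vertex are simple graphs. *)
Definition nontrivial_3cut (S : {set V}) : Prop :=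
  [/\ #|cut_edges S| = 3, 1 < #|S| & 1 < #|~: S|] /\
  [/\ connected_in S, connected_in (~: S) &
      forall x, #|[set y | adj x y && ((x \in S) != (y \in S))]| <= 1].

End GraphDefs.

Record sgraph := SGraph { vert : finType; gadj : rel vert }.
Arguments gadj : clear implicits.

(* cycle rank beta(H) = |E| - |V| + 1 (for connected H, |E| >= |V| - 1) *)
Definition beta (H : sgraph) : nat := #|edges (gadj H)| + 1 - #|[set: vert H]|.
Definition cyclically_odd (H : sgraph) : bool := odd (beta H).

(* \bar H for the side S: G[S] plus a new vertex (None) joined to the ends in S
   of the cut edges *)
Definition piece_vert (G : sgraph) (S : {set vert G}) : finType :=
  option {x : vert G | x \in S}.

Definition piece_adj (G : sgraph) (S : {set vert G}) : rel (piece_vert S) :=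
  fun u v =>
    match u, v with
    | Some x, Some y => gadj G (val x) (val y)
    | None, Some y | Some y, None => [exists z, (z \notin S) && gadj G (val y) z]
    | None, None => false
    end.

Definition piece (G : sgraph) (S : {set vert G}) : sgraph :=
  @SGraph (piece_vert S) (@piece_adj G S).

Inductive canon_decomp : sgraph -> seq sgraph -> Prop :=
| cd_factor (G : sgraph) :
    (forall S : {set vert G}, ~ nontrivial_3cut (gadj G) S) ->
    canon_decomp G [:: G]
| cd_split (G : sgraph) (S : {set vert G}) (F1 F2 : seq sgraph) :
    nontrivial_3cut (gadj G) S ->
    canon_decomp (piece S) F1 ->
    canon_decomp (piece (~: S)) F2 ->
    canon_decomp G (F1 ++ F2).

(* Main.v *)
(** Let e(X) be the number of edges inside X, and let need(X) be the least
integer greater than e(X) with the parity of |X|.  If, on a vertex set U, the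
sum of need over the parts of every partition of U is at most e(U) + 1, then
there are odd weights m with m(X) > e(X) for all nonempty X in U and
m(U) = e(U) + 1 (the hard direction of Nebesky's theorem on maximum genus, with
orientations replaced by their in-degree vectors).  The vertices of weight 1
induce a forest, and counting edges shows that it is a tree whose complement
has as few inner edges as possible.

In a 3-edge-connected cubic graph need(X) exceeds 3|X|/2 only if X has three
boundary edges and |X| = 3 mod 4.  Three-edge cuts do not cross, so along the
canonical decomposition such sets do not exist if no factor is cyclically odd,
and pairwise intersect if there is one cyclically odd factor.  Hence the
partition condition holds on the complement of a vertex, respectively of the two
ends of an edge. *)
Require Import Defs.
From mathcomp Require Import all_boot zify.

Set Implicit Arguments. Unset Strict Implicit. Unset Printing Implicit Defensive.

(** * Weights with prescribed parities *)

Section ParityVector.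
Variable V : finType.
Implicit Types (X Y Z U W : {set V}) (D : {set V * V}) (p m : V -> nat).
Implicit Types (P Q O S : {set {set V}}).

(** An edge is stored as an ordered pair, its direction being arbitrary, so that deleting one edge
    is [D :\ d]. *)
Definition inner D X : nat := \sum_(d in D) ((d.1 \in X) && (d.2 \in X)).

(** Only the parity of [p] matters; it is general because the induction flips it at single
    vertices. *)
Definition need D p X : nat :=
  inner D X + 1 + odd (inner D X + 1 + \sum_(v in X) p v).

Lemma need_gt D p X : inner D X < need D p X.
Proof. by rewrite /need; lia. Qed.

Lemma odd_need D p X : odd (need D p X) = odd (\sum_(v in X) p v).
Proof. by rewrite /need; lia. Qed.

Lemma need_min D p X k :
  inner D X < k -> odd k = odd (\sum_(v in X) p v) -> need D p X <= k.
Proof. by rewrite /need; lia. Qed.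

Lemma inner_supermodular D X Y :
  inner D X + inner D Y <= inner D (X :|: Y) + inner D (X :&: Y).
Proof.
rewrite /inner -!big_split; apply: leq_sum => d _ /=; rewrite !inE.
by case: (d.1 \in X); case: (d.1 \in Y); case: (d.2 \in X); case: (d.2 \in Y).
Qed.

Lemma inner_sub D X Y : X \subset Y -> inner D X <= inner D Y.
Proof.
move=> /subsetP sXY; apply: leq_sum => d _.
by case: (boolP (_ && _)) => // /andP[/sXY -> /sXY ->].
Qed.

Lemma inner0 D : inner D set0 = 0.
Proof. by rewrite /inner big1 // => d _; rewrite inE. Qed.

(** * Representatives of sets under submodular bounds *)

Definition meets X Z : nat := X :&: Z != set0.

Lemma meets_submodular X Y Z :
  meets X (Y :|: Z) + meets X (Y :&: Z) <= meets X Y + meets X Z.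
Proof.
rewrite /meets setIUr setU_eq0 negb_and setIIr.
case: (eqVneq (X :&: Y) set0) => [->|_]; first by rewrite set0I eqxx addn0.
case: (eqVneq (X :&: Z) set0) => [->|_]; first by rewrite setI0 eqxx.
by rewrite add1n ltnS leq_b1.
Qed.

Definition submodular (c : {set V} -> nat) :=
  forall Y Z, c (Y :|: Z) + c (Y :&: Z) <= c Y + c Z.

(* Tight sets meeting X are closed under intersection, so any u in the smallest
   of them can serve all of them. *)
Lemma representative U (e c : {set V} -> nat) X :
    (forall Y Z, e Y + e Z <= e (Y :|: Z) + e (Y :&: Z)) -> e set0 = 0 ->
    submodular c -> X != set0 ->
    (forall Z, Z != set0 -> Z \subset U -> e Z < c Z + 2 * meets X Z) ->
  exists2 u, u \in X & forall Z, Z != set0 -> Z \subset U ->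
    e Z < c Z + meets X Z + (u \in Z).
Proof.
move=> supe e0 subc Xn0 h.
pose tight Z := [&& X :&: Z != set0, Z \subset U & e Z == (c Z).+1].
(* Supermodularity of [e] against submodularity of [c] forces [e (Y :&: Z)] above [c (Y :&: Z)]; by
   the hypothesis this happens only if [Y :&: Z] meets [X]. *)
have tightI Y Z : tight Y -> tight Z -> tight (Y :&: Z).
  move=> /and3P[mY sY /eqP eY] /and3P[mZ sZ /eqP eZ].
  have sU : Y :|: Z \subset U by rewrite subUset sY.
  have sI : Y :&: Z \subset U by rewrite subIset // sY.
  have n0 : Y :|: Z != set0.
    by apply: contraNneq mY => /eqP; rewrite setU_eq0 => /andP[/eqP-> _]; rewrite setI0.
  move: (h _ ^~ sI) eY eZ (supe Y Z) (subc Y Z) (h _ n0 sU).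
  rewrite /tight sI /meets; clear -e0.
  case: (eqVneq (Y :&: Z) set0) => [-> _ | nI /(_ isT)]; first by rewrite e0;
    case: eqP => /=; lia.
  by case: (eqVneq (X :&: (Y :&: Z)) set0) => _; case: (X :&: (Y :|: Z) != set0) => /=;
    clear; lia.
have fin u : u \in X -> (forall Z, tight Z -> u \in Z) ->
    forall Z, Z != set0 -> Z \subset U -> e Z < c Z + meets X Z + (u \in Z).
  move=> uX ut Z Zn0 sZ; have := h Z Zn0 sZ.
  case: (boolP (tight Z)) => [/ut -> | nt]; first by rewrite /meets; case: (_ != _); lia.
  move: nt; rewrite /tight sZ /=.
  have [uZ|uZ] := boolP (u \in Z).
    have -> : X :&: Z != set0 by apply/set0Pn; exists u; rewrite inE uX.
    by rewrite /meets; case: (_ != _); lia.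
  by rewrite /meets; case: (_ != _) => /=; lia.
have [Z0 t0 | nt] := pickP tight.
  case: (@arg_minnP _ Z0 tight (fun Z => #|Z|) t0) => Zm tm minm.
  have /and3P[/set0Pn[u]] := tm; rewrite inE => /andP[uX uZ] _ _.
  exists u => //; apply: fin => // Z tZ.
  have /minm := tightI _ _ tm tZ => le.
  have /eqP E : Zm :&: Z == Zm by rewrite eqEcard subsetIl le.
  by move: uZ; rewrite -E inE => /andP[].
have /set0Pn[u uX] := Xn0; exists u => //; apply: fin => // Z.
by rewrite nt.
Qed.

(** Induction on [O]: the demands of the other sets are moved into [c], and once [u] serves [X] the
    term [meets X Z + (u \in Z)] moves there too. All these terms are submodular in [Z]. *)
Lemma representatives U (e c : {set V} -> nat) O :
    (forall Y Z, e Y + e Z <= e (Y :|: Z) + e (Y :&: Z)) -> e set0 = 0 ->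
    submodular c -> U != set0 -> set0 \notin O ->
    (forall Z, Z != set0 -> Z \subset U -> e Z < c Z + \sum_(X in O) 2 * meets X Z) ->
  exists u : {set V} -> V, (forall X, X \in O -> u X \in X) /\
    forall Z, Z != set0 -> Z \subset U ->
    e Z < c Z + \sum_(X in O) (meets X Z + (u X \in Z)).
Proof.
move=> supe e0 + /set0Pn[u0 _].
elim: {O}#|O| {-2}O (leqnn #|O|) c => [|k IH] O.
  rewrite leqn0 cards_eq0 => /eqP-> c subc _ h.
  exists (fun=> u0); split=> [X|Z n0 /(h Z n0)]; rewrite ?inE // !big_set0 //.
have [-> _|[X XO] leO] := set_0Vmem O; first by apply: IH; rewrite cards0.
move=> c subc O0 h.
have Xn0 : X != set0 by apply: contraNneq O0 => <-.
have [||u uX hu] := @representative U e (fun Z =>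
  c Z + \sum_(Y in O :\ X) 2 * meets Y Z) X supe e0 _ Xn0.
- move=> Y Z; have := subc Y Z.
  suff : \sum_(W in O :\ X) 2 * meets W (Y :|: Z)
       + \sum_(W in O :\ X) 2 * meets W (Y :&: Z)
     <= \sum_(W in O :\ X) 2 * meets W Y + \sum_(W in O :\ X) 2 * meets W Z by lia.
  by rewrite -!big_split; apply: leq_sum => W _ /=; have := meets_submodular W Y Z; lia.
- by move=> Z n0 sZ; have := h Z n0 sZ; rewrite (big_setD1 X) //=; lia.
have [|Y Z||Z n0 sZ|w [wO hw]] := IH (O :\ X) _ (fun Z => c Z + meets X Z + (u \in Z)).
- by have := cardsD1 X O; rewrite XO; lia.
- have := subc Y Z; have := meets_submodular X Y Z; rewrite !inE.
  by case: (u \in Y); case: (u \in Z) => /=; lia.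
- by rewrite !inE negb_and O0 orbT.
- by have := hu Z n0 sZ; clear; lia.
exists (fun Y => if Y == X then u else w Y); split=> [Y|Z n0 sZ].
  by case: eqP => [->//|/eqP YX] YO; apply: wO; rewrite !inE YX.
have -> : \sum_(Y in O) (meets Y Z + ((if Y == X then u else w Y) \in Z)) =
          meets X Z + (u \in Z) + \sum_(Y in O :\ X) (meets Y Z + (w Y \in Z)).
  rewrite (big_setD1 X XO) /= eqxx; congr (_ + _).
  by apply: eq_bigr => Y; rewrite !inE => /andP[/negPf->].
by rewrite !addnA; apply: hw.
Qed.

(** * Partitions and sums of needs *)

Lemma inner_partition D P U Z : partition P U -> Z \subset U ->
  inner D Z = inner [set d in D | ~~ [exists X in P, (d.1 \in X) && (d.2 \in X)]] Z
              + \sum_(X in P) inner D (X :&: Z).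
Proof.
move=> /and3P[/eqP cP tP _] /subsetP sZ.
rewrite /inner exchange_big /= big_mkcond.
rewrite [X in _ = X + _]big_mkcond [X in _ = _ + X]big_mkcond.
rewrite -big_split; apply: eq_bigr => d _ /=; rewrite !inE; case: (d \in D) => //=.
case: (boolP [exists _ in _, _]) => /= [/exists_inP[X XP /andP[d1 d2]] | nX]; last first.
  rewrite [X in _ = _ + X]big1 ?addn0 // => X XP; rewrite !inE.
  case: (boolP (d.1 \in X)) => //= d1; case: (boolP (d.2 \in X)) => //= d2;
    last by rewrite andbF.
  by case/exists_inP: nX; exists X; rewrite ?d1.
rewrite (big_setD1 X) //= !inE d1 d2 big1 ?addn0 // => Y; rewrite !inE => /andP[YX YP].
have /disjointFr -> // : [disjoint X & Y] by apply: (trivIsetP tP) => //; rewrite eq_sym.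
Qed.

(** Serves in both directions: with [Q] a single block it merges the parts in [S], with [S] a single
    part it refines that part. *)
Lemma partition_replace P Q S U :
    partition P U -> S \subset P -> partition Q (cover S) ->
  partition (Q :|: P :\: S) U /\
  forall f : {set V} -> nat, \sum_(X in Q :|: P :\: S) f X
    = \sum_(X in Q) f X + \sum_(X in P :\: S) f X.
Proof.
move=> /and3P[/eqP cP tP nP] sSP /and3P[/eqP cQ tQ nQ].
have tS := trivIsetS sSP tP.
have dC : [disjoint cover Q & cover (P :\: S)].
  rewrite cQ -setI_eq0; apply/eqP/setP => x; rewrite !inE; apply/negP.
  case/andP=> /bigcupP[X XS xX] /bigcupP[Y]; rewrite inE => /andP[YS YP] xY.
  have XY : X != Y by apply: contraNneq YS => <-.
  by have /disjointFr/(_ xX) := trivIsetP tP X Y (subsetP sSP _ XS) YP XY; rewrite xY.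
split.
  apply/and3P; split; last by rewrite !inE negb_or nQ negb_and nP orbT.
    rewrite /cover bigcup_setU -/(cover Q) cQ -bigcup_setU -/(cover _) -cP; apply/eqP;
      congr cover.
    by apply/setP => X; rewrite !inE; case: (boolP (X \in S)) => // /(subsetP sSP) ->.
  by apply: trivIsetU => //; apply: trivIsetD.
move=> f; rewrite -bigU /=; first by apply: eq_bigl => X; rewrite inE.
rewrite -setI_eq0; apply/eqP/setP => X; rewrite !inE; apply/negP => /andP[XQ XD].
have /set0Pn[x xX] : X != set0 by apply: contraNneq nQ => <-.
have /(disjointFr dC) : x \in cover Q by apply/bigcupP; exists X.
by move/negP; apply; apply/bigcupP; exists X; rewrite // inE.
Qed.

Lemma sum_need_odd D p P U : partition P U ->
  odd (\sum_(X in P) need D p X) = odd (\sum_(v in U) p v).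
Proof.
move=> pP; rewrite (set_partition_big _ pP) /=.
by rewrite !(big_morph odd oddD (erefl : odd 0 = false)); apply: eq_bigr => X _;
  rewrite odd_need (big_morph odd oddD (erefl : odd 0 = false)).
Qed.

(** Adding one, rather than negating, lets the same map act on parities and on weights. *)
Definition flip p u : V -> nat := fun v => p v + (v == u).

Lemma sum_flip p u X : \sum_(v in X) flip p u v = \sum_(v in X) p v + (u \in X).
Proof.
rewrite big_split /=; congr (_ + _).
have [uX|uX] := boolP (u \in X).
  by rewrite (big_setD1 u) //= eqxx big1 // => v; rewrite !inE => /andP[/negPf->].
by rewrite big1 // => v vX; case: eqP => // vu; rewrite -vu vX in uX.
Qed.

Lemma sum_need_flip D p u P U : partition P U ->
  \sum_(X in P) need D (flip p u) X <= (\sum_(X in P) need D p X).+1.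
Proof.
move=> pP; have tP := partition_trivIset pP.
have H X : need D (flip p u) X <= need D p X + (u \in X).
  by rewrite /need sum_flip; case: (u \in X); lia.
apply: (@leq_trans (\sum_(X in P) (need D p X + (u \in X)))).
  by apply: leq_sum => X _; apply: H.
rewrite big_split /= -addn1 leq_add2l.
have [/exists_inP[X XP uX]|n] := boolP [exists X in P, u \in X].
  rewrite (big_setD1 X) //= uX big1 // => Y; rewrite !inE => /andP[YX YP].
  by have /disjointFl/(_ uX) -> := trivIsetP tP Y X YP XP YX.
by rewrite big1 // => X XP; apply/eqP; rewrite eqb0; apply: contraNN n => uX;
  apply/exists_inP; exists X.
Qed.

(** By Hakimi's criterion, lowering [m] by one at any root in [U] gives the in-degree vector of an
    orientation of the edges inside [U] in which the root reaches all of [U]. *)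
Definition parity_vector D p U m : Prop :=
  [/\ forall v, v \in U -> odd (m v) = odd (p v),
      forall Z, Z != set0 -> Z \subset U -> inner D Z < \sum_(v in Z) m v
    & \sum_(v in U) m v = (inner D U).+1].

Lemma sum_pblock P U (M : {set V} -> V -> nat) Z :
    partition P U -> Z \subset U ->
  \sum_(v in Z) M (pblock P v) v = \sum_(X in P) \sum_(v in X :&: Z) M X v.
Proof.
move=> pP sZ.
rewrite (eq_bigl (fun v => (v \in U) && (v \in Z))); last first.
  by move=> v; case: (boolP (v \in Z)) => [/(subsetP sZ) ->|]; rewrite ?andbF.
rewrite (set_partition_big_cond _ pP) /=; apply: eq_bigr => X XP.
apply: eq_big => [v|v /andP[vX _]]; first by rewrite inE.
by rewrite (def_pblock (partition_trivIset pP) XP vX).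
Qed.

(* In a tight partition P, the parts in O have one unit of weight to spare beyond
   what their inner edges require; the representatives u tell where it goes. *)
Lemma parity_vector_glue D p U P :
    partition P U -> U != set0 ->
    let O := [set X in P | need D p X == (inner D X).+2] in
    (forall Z, Z != set0 -> Z \subset U ->
       inner [set d in D | ~~ [exists X in P, (d.1 \in X) && (d.2 \in X)]] Z
         < \sum_(X in P) meets X Z + \sum_(X in O) meets X Z) ->
    (forall X, X \in P -> X \notin O -> exists m, parity_vector D p X m) ->
    (forall X u, X \in O -> u \in X -> exists m, parity_vector D (flip p u) X m) ->
    \sum_(X in P) need D p X = (inner D U).+1 ->
  exists m, parity_vector D p U m.
Proof.
move=> pP Un0 O; set D' := [set d in D | _] => cross solE solO tight.
(* Parts outside [O] give one unit of slack and form the fixed submodular term; parts in [O] give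
   two, one of which gets pinned to a representative. *)
have [] := @representatives U (inner D') (fun Z => \sum_(X in P :\: O) meets X Z) O
  (inner_supermodular D') (inner0 D') _ Un0 _ _.
- move=> Y Z; rewrite -!big_split; apply: leq_sum => X _; exact: meets_submodular.
- by rewrite inE (partition0 pP).
- move=> Z Zn0 sZ; have := cross Z Zn0 sZ.
  have sOP : O \subset P by apply/subsetP => X; rewrite inE => /andP[].
  rewrite (big_setID O) /= (setIidPr sOP) -big_distrr /=; lia.
move=> u [uO hu].
have part X : exists m, X \in P ->
    [/\ forall v, v \in X -> odd (m v) = odd (p v),
        forall Z, Z != set0 -> Z \subset X ->
          inner D Z + (X \in O) * (u X \in Z) < \sum_(v in Z) m v
      & \sum_(v in X) m v = need D p X].
  have [XP|] := boolP (X \in P); last by exists p.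
  have [XO|nO] := boolP (X \in O).
    have [m [m1 m2 m3]] := solO X (u X) XO (uO X XO).
    (* The part is solved with the parity flipped at [u X]; the extra unit placed there restores the
       parity and raises the total to [need D p X]. *)
    exists (flip m (u X)) => _; split=> [v vX|Z Zn0 sZ|].
    - by have := m1 v vX; rewrite /flip !oddD; do 3!case: odd.
    - by rewrite sum_flip mul1n -addSn leq_add2r; apply: m2.
    - by rewrite sum_flip uO // m3; move: XO; rewrite inE XP addn1 => /eqP.
  have [m [m1 m2 m3]] := solE X XP nO.
  exists m => _; split=> [//|Z Zn0 sZ|]; first by rewrite addn0; apply: m2.
  by rewrite m3; move: nO; rewrite inE XP /need; case: odd;
    rewrite /= ?addn0 ?addn1 ?eqxx.
have {part} [M hM] := fin_all_exists part.
exists (fun v => M (pblock P v) v); split=> [v vU|Z Zn0 sZ|].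
- have cv : v \in cover P by rewrite (cover_partition pP).
  have [+ _ _] := hM _ (pblock_mem cv); apply; by rewrite mem_pblock.
- rewrite (sum_pblock M pP sZ) (inner_partition D pP sZ) -/D'.
  have := hu Z Zn0 sZ.
  (* The slack of the parts met by [Z] pays for the edges of [Z] that run between parts. *)
  suff : \sum_(X in P) inner D (X :&: Z) +
    (\sum_(X in P :\: O) meets X Z + \sum_(X in O) (meets X Z + (u X \in Z)))
     <= \sum_(X in P) \sum_(v in X :&: Z) M X v by lia.
  have sOP : O \subset P by apply/subsetP => X; rewrite inE => /andP[].
  have -> : \sum_(X in P :\: O) meets X Z + \sum_(X in O) (meets X Z + (u X \in Z))
    = \sum_(X in P) (meets X Z + (X \in O) * (u X \in Z)).
    rewrite [RHS](big_setID O) /= (setIidPr sOP) addnC; congr (_ + _).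
      by apply: eq_bigr => X ->; rewrite mul1n.
    by apply: eq_bigr => X; rewrite inE => /andP[/negPf-> _]; rewrite addn0.
  rewrite -big_split; apply: leq_sum => X XP /=.
  have [_ h _] := hM X XP; rewrite /meets.
  case: (eqVneq (X :&: Z) set0) => [E|n0] /=.
    rewrite E inner0 big_set0; have [XO|] := boolP (X \in O) => //.
    have := uO X XO; have /setP/(_ (u X)) := E; rewrite !inE => /[swap] ->.
    by case: (_ \in _).
  have := h _ n0 (subsetIl _ _); rewrite in_setI.
  have [XO|nO] := boolP (X \in O); last by rewrite !mul0n; clear; lia.
  by rewrite uO //=; clear; lia.
rewrite (sum_pblock M pP (subxx U)) -tight; apply: eq_bigr => X XP.
by have [_ _ <-] := hM X XP; rewrite (setIidPl (partitionS pP XP)).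
Qed.

(** Merge the parts met by [Z] into one block. Compared with the tight [P], the hypothesis shows
    that this block has fewer inner edges than the total need of the merged parts; cancel the edges
    inside parts, each need exceeding its edge count by 1 or 2. *)
Lemma crossing_bound D p U P :
    partition P U ->
    (forall Q, partition Q U -> \sum_(X in Q) need D p X <= (inner D U).+1) ->
    \sum_(X in P) need D p X = (inner D U).+1 ->
  forall Z, Z != set0 -> Z \subset U ->
    inner [set d in D | ~~ [exists X in P, (d.1 \in X) && (d.2 \in X)]] Z
      < \sum_(X in P) meets X Z
        + \sum_(X in [set X in P | need D p X == (inner D X).+2]) meets X Z.
Proof.
move=> pP h tight Z Zn0 sZ; set D' := [set d in D | _].
pose S := [set X in P | X :&: Z != set0].
have sSP : S \subset P by apply/subsetP => X; rewrite inE => /andP[].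
have sZS : Z \subset cover S.
  apply/subsetP => z zZ; have : z \in cover P by rewrite (cover_partition pP) (subsetP
    sZ).
  case/bigcupP => X XP zX; apply/bigcupP; exists X => //; rewrite inE XP.
  by apply/set0Pn; exists z; rewrite inE zX.
have sSU : cover S \subset U.
  by apply/bigcupsP => X /(subsetP sSP) XP; apply: partitionS pP XP.
have pC : partition [set cover S] (cover S).
  rewrite /partition cover1 trivIset1 eqxx /= inE eq_sym.
  by have /set0Pn[z /(subsetP sZS) zS] := Zn0; apply/set0Pn; exists z.
have [pQ sQ] := partition_replace pP sSP pC.
have := h _ pQ; rewrite -tight sQ big_set1 [X in _ <= X](big_setID S) /= (setIidPr sSP)
  leq_add2r.
move/(leq_trans (need_gt D p _)) => lt.
have EW : inner D (cover S) = inner D' (cover S) + \sum_(X in S) inner D X.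
  rewrite (inner_partition D pP sSU) -/D'; congr (_ + _).
  rewrite [LHS](big_setID S) /= (setIidPr sSP) [X in _ + X]big1 ?addn0 => [|X].
    by apply: eq_bigr => X XS; rewrite (setIidPl _) //; apply: bigcup_sup XS.
  rewrite inE => /andP[XS XP]; suff -> : X :&: cover S = set0 by rewrite inner0.
  apply/setP => x; rewrite !inE; apply/negP => /andP[xX /bigcupP[Y YS xY]].
  have XY : X != Y by apply: contraNneq XS => ->.
  have := trivIsetP (partition_trivIset pP) X Y XP (subsetP sSP _ YS) XY.
  by move/disjointFr/(_ xX); rewrite xY.
apply: leq_ltn_trans (inner_sub D' sZS) _.
have SE f : \sum_(X in [set X in P | f X]) meets X Z = \sum_(X in S) f X.
  rewrite [LHS]big_mkcond [RHS]big_mkcond; apply: eq_bigr => X _ /=; rewrite !inE /meets.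
  by case: (X \in P); case: (f X); case: (_ != _).
have -> : \sum_(X in P) meets X Z = \sum_(X in S) 1.
  by rewrite -(SE xpredT); apply: eq_bigl => X; rewrite inE andbT.
rewrite SE -big_split /=.
suff : inner D (cover S) < \sum_(X in S) inner D X
    + \sum_(X in S) (1 + (need D p X == (inner D X).+2)).
  by rewrite EW [X in X < _]addnC ltn_add2l.
rewrite -big_split /=; apply: leq_trans lt _; apply: leq_sum => X _.
by rewrite /need; case: odd; move: (inner D X); clear; lia.
Qed.

Lemma partition_le1 Q U : partition Q U -> U != set0 -> #|Q| <= 1 -> Q = [set U].
Proof.
move=> pQ Un0 Q1; have cQ := cover_partition pQ.
have /cards1P[X QX] : #|Q| == 1.
  rewrite eqn_leq Q1 card_gt0; apply: contraNneq Un0 => Q0.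
  by rewrite -cQ Q0 /cover big_set0.
by rewrite QX -cQ QX cover1.
Qed.

Lemma need_le D D' p X : inner D' X <= inner D X -> need D' p X <= need D p X.
Proof.
by move=> le; apply: need_min; rewrite ?odd_need // (leq_ltn_trans le) ?need_gt.
Qed.

(** Take a tight partition with the most parts. If it has several, maximality passes the hypothesis
    on to each part, even after a flip where the need is two above the edge count, and the solutions
    glue. If it is trivial, all other partitions have room for deleting an edge. *)
Theorem parity_vector_exists D p U :
    U != set0 ->
    (forall P, partition P U -> \sum_(X in P) need D p X <= (inner D U).+1) ->
  exists m, parity_vector D p U m.
Proof.
elim: {D U}(#|D| + #|U|) {-2}D {-2}U (leqnn (#|D| + #|U|)) p => [|k IH] D U.
  by rewrite leqn0 addn_eq0 => /andP[_]; rewrite cards_eq0 => /eqP-> p; rewrite eqxx.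
move=> leDU p Un0 h.
pose tight P := partition P U && (\sum_(X in P) need D p X == (inner D U).+1).
have pU : partition [set U] U by rewrite /partition cover1 trivIset1 eqxx inE eq_sym.
(* The trivial partition is tight, since its need lies strictly above [inner D U]; so every sum of
   needs has the parity of the bound. *)
have oddP P : partition P U -> odd (\sum_(X in P) need D p X) = odd (inner D U).+1.
  move=> pP; rewrite (sum_need_odd D p pP) -(odd_need D).
  by have := h _ pU; rewrite big_set1 => le; congr odd; have := need_gt D p U; lia.
have tU : tight [set U].
  by rewrite /tight pU; have := h _ pU; rewrite big_set1; have := need_gt D p U; lia.
case: (@arg_maxnP _ [set U] tight (fun P => #|P|) tU) => P /andP[pP /eqP tP] maxP.
have [P1 | P2] := leqP #|P| 1.
  (* Not being tight costs two units, by parity. *)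
  have loose Q : partition Q U -> 1 < #|Q| -> \sum_(X in Q) need D p X < inner D U.
    move=> pQ Q2; have := h _ pQ; have := oddP _ pQ.
    case: (boolP (tight Q)) (maxP Q) => [_ /(_ isT) le | nt _];
      first by have := leq_trans (leq_trans Q2 le) P1.
    move: nt; rewrite /tight pQ /=; clear; lia.
  have [U1 | U2] := leqP #|U| 1.
    have /cards1P[v Uv] : #|U| == 1 by rewrite eqn_leq U1 card_gt0.
    exists (fun=> need D p U); rewrite Uv; split=> [w|Z Zn0|].
    - by rewrite inE => /eqP->; rewrite odd_need big_set1.
    - by rewrite subset1 (negPf Zn0) orbF => /eqP->; rewrite big_set1 need_gt.
    - by rewrite big_set1 -Uv; have := tU; rewrite /tight big_set1 => /andP[_ /eqP].
  (* Delete an edge d inside U and flip the parity at one end of d, where the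
     deleted edge will be counted. *)
  have [d dP] : exists d, (d \in D) && ((d.1 \in U) && (d.2 \in U)).
    apply/existsP; apply: contraLR U2 => /existsPn nd.
    have e0 : inner D U = 0.
      by apply: big1 => d dD; have := nd d; rewrite dD /= => /negPf->.
    (* Without an edge in [U], splitting off one vertex would give a sum of needs below 0. *)
    have /set0Pn[v vU] := Un0; rewrite -leqNgt leqNgt; apply/negP => U2.
    have Wn0 : U :\ v != set0 by rewrite -card_gt0; have := cardsD1 v U; rewrite vU; lia.
    have pW : partition [set U :\ v] (U :\ v).
      by rewrite /partition cover1 trivIset1 eqxx inE eq_sym.
    have vn0 : [set v] != set0 by apply/set0Pn; exists v; rewrite inE.
    have := partitionU1 pW vn0; rewrite setD1K // disjoints1 !inE eqxx => /(_ isT) pQ.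
    have := loose _ pQ; rewrite e0 cards2 ltnS lt0b => /implyP; rewrite implybF negbK.
    by move/eqP/setP/(_ v); rewrite !inE eqxx.
  have [dD d1 d2] := and3P dP; set v := d.2; set D' := D :\ d.
  have eD X : inner D X = inner D' X + ((d.1 \in X) && (v \in X)).
    by rewrite /inner (big_setD1 d) //= addnC.
  have eU : inner D U = (inner D' U).+1 by rewrite eD d1 d2 addn1.
  have [||m [m1 m2 m3]] := IH D' U _ (flip p v) Un0.
  - by move: leDU; rewrite (cardsD1 d D) dD.
  (* For several parts, one of the two spare units pays for the lower edge count and the other for
     the flip; for a single part, parity suffices. *)
  - move=> Q pQ; have [Q1 | Q2] := leqP #|Q| 1.
      rewrite (partition_le1 pQ Un0 Q1) big_set1; apply: need_min => //.
      rewrite sum_flip d2 -eU addn1 oddS -(sum_need_odd D p pQ) oddP //.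
      by rewrite oddS negbK.
    have := loose Q pQ Q2; have := sum_need_flip D p v pQ.
    suff : \sum_(X in Q) need D' (flip p v) X <= \sum_(X in Q) need D (flip p v) X by
      rewrite eU; clear; lia.
    by apply: leq_sum => X _; apply: need_le; rewrite eD leq_addr.
  exists (flip m v); split=> [w wU|Z Zn0 sZ|].
  - by have := m1 w wU; rewrite /flip !oddD; do 3!case: odd.
  - move: (m2 Z Zn0 sZ); rewrite sum_flip eD;
    move: (inner D' Z) (\sum_(w in Z) m w) => a b.
    by case: (v \in Z); case: (d.1 \in Z); rewrite /= ?addn0 ?addn1 ?ltnS // => /ltnW.
  - by rewrite sum_flip m3 d2 eU addn1.
have small X : X \in P -> #|D| + #|X| <= k.
  move=> XP; rewrite -ltnS; apply: leq_trans leDU; rewrite ltn_add2l; apply: proper_card.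
  rewrite properEneq (partitionS pP XP) andbT; apply: contraTneq P2 => XU.
  rewrite -leqNgt leqNgt; apply/negP => /card_gt1P[Y [Z [YP ZP YZ]]].
  wlog YX : Y Z YP ZP YZ / Y != X.
    move=> W; case: (eqVneq Y X) => [YX|]; last exact: W YZ.
    by apply: (W Z Y) => //; rewrite -?YX eq_sym.
  have /set0Pn[y yY] := partition_neq0 pP YP.
  have /disjointFr/(_ yY) := trivIsetP (partition_trivIset pP) Y X YP XP YX.
  by rewrite XU (subsetP (partitionS pP YP) y yY).
(* If refining a part kept the sum of needs, it would give a tight partition, so by maximality one
   with no additional part. *)
have refine X Q : X \in P -> partition Q X ->
    \sum_(Y in Q) need D p Y <= need D p X /\
    (\sum_(Y in Q) need D p Y = need D p X -> #|Q| <= 1).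
  move=> XP pQ.
  have sX : [set X] \subset P by rewrite sub1set.
  have [|pR sR] := @partition_replace P Q _ U pP sX; first by rewrite cover1; exact: pQ.
  have := h _ pR; rewrite sR -tP [X in _ <= X](big_setD1 X) //= leq_add2r => le;
    split=> // E.
  have /maxP : tight (Q :|: P :\ X) by rewrite /tight pR sR E -tP [X in _ ==
    X](big_setD1 X) //=.
  by rewrite /= -!sum1_card sR [X in _ <= X](big_setD1 X) //= leq_add2r.
(* For a part not in [O], the need is one above the edge count, and [refine] is the induction
   hypothesis's premise. *)
apply: (parity_vector_glue pP Un0 (crossing_bound pP h tP)) => // [X XP nO | X u XO uX].
  apply: IH; [exact: small | exact: partition_neq0 pP XP | move=> Q /(refine X Q XP)[le
    _]].
  move: nO le; rewrite inE XP /need /=; case: odd => /=;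
    rewrite ?addn0 addn1 ?addn1 ?eqxx //.
have [XP /eqP nX] : X \in P /\ need D p X == (inner D X).+2 by apply/andP;
  rewrite inE in XO.
apply: IH; [exact: small | exact: partition_neq0 pP XP | move=> Q pQ].
have [le eq] := refine X Q XP pQ.
have [Q1|Q2] := leqP #|Q| 1.
  rewrite (partition_le1 pQ (partition_neq0 pP XP) Q1) big_set1; apply: need_min => //.
  have := odd_need D p X; rewrite nX sum_flip uX addn1 /= => <-; by rewrite negbK.
(* A proper refinement is strictly below [need D p X], hence two below by parity, which leaves room
   for the flip. *)
have := sum_need_flip D p u pQ; have : odd (\sum_(Y in Q) need D p Y) = odd (need D p X).
  by rewrite (sum_need_odd D p pQ) odd_need.
move: le eq; rewrite nX; clear -Q2; lia.
Qed.

End ParityVector.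

(** * Edge boundaries in cubic graphs *)

Section Counting.
Variables (V : finType) (adj : rel V).
Hypotheses (adj_sym : symmetric adj) (adj_irr : irreflexive adj).
Implicit Types (X Y Z S A B : {set V}).

(** Ordered pairs are counted: an edge inside [X] counts twice in [arcs X X], a boundary edge once
    in [boundary X]. *)
Definition arcs X Y : nat :=
  \sum_(d : V * V | adj d.1 d.2) ((d.1 \in X) && (d.2 \in Y)).

Definition boundary X : nat := arcs X (~: X).

(** Listing each edge once, from lower to higher rank, makes [inner oedges X] the number of edges
    induced by [X]. *)
Definition oedges : {set V * V} :=
  [set d | adj d.1 d.2 && (enum_rank d.1 < enum_rank d.2)].

Lemma arcsE X Y : arcs X Y = \sum_(x in X) #|[set y in Y | adj x y]|.
Proof.
rewrite /arcs big_mkcond.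
rewrite -(pair_big xpredT xpredT (fun x y =>
  if adj x y then ((x \in X) && (y \in Y) : nat) else 0)) /=.
rewrite [RHS]big_mkcond; apply: eq_bigr => x _.
case: (x \in X) => /=; last by rewrite big1 // => y _; case: ifP.
rewrite -sum1_card [RHS]big_mkcond; apply: eq_bigr => y _; rewrite inE andbC.
by case: (adj x y); case: (y \in Y).
Qed.

Lemma arcsC X Y : arcs X Y = arcs Y X.
Proof.
pose sw := fun d : V * V => (d.2, d.1).
rewrite /arcs (reindex_inj (inv_inj (_ : involutive sw))) /=; last by case.
by apply: eq_big => [d|d _]; [rewrite adj_sym | rewrite andbC].
Qed.

Lemma arcs_split X Y Z : arcs X Y = arcs X (Y :&: Z) + arcs X (Y :\: Z).
Proof.
rewrite /arcs -big_split; apply: eq_bigr => d _; rewrite !inE.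
by case: (d.1 \in X); case: (d.2 \in Y); case: (d.2 \in Z).
Qed.

Lemma boundaryC X : boundary (~: X) = boundary X.
Proof. by rewrite /boundary setCK arcsC. Qed.

Lemma boundary_submodular X Y :
  boundary (X :&: Y) + boundary (X :|: Y) <= boundary X + boundary Y.
Proof.
rewrite /boundary /arcs -!big_split; apply: leq_sum => d _; rewrite !inE /=.
by case: (d.1 \in X); case: (d.2 \in X); case: (d.1 \in Y); case: (d.2 \in Y).
Qed.

Lemma arcs_inner X : arcs X X = (inner oedges X).*2.
Proof.
rewrite /arcs (bigID (fun d : V * V => enum_rank d.1 < enum_rank d.2)) /=.
rewrite -addnn; congr (_ + _); first by apply: eq_bigl => d; rewrite inE.
pose sw := fun d : V * V => (d.2, d.1).
rewrite (reindex_inj (inv_inj (_ : involutive sw))) /=; last by case.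
apply: eq_big => [d|d _]; last by rewrite andbC.
rewrite inE adj_sym; case: (boolP (adj _ _)) => //= a.
rewrite -leqNgt leq_eqVlt; case: eqP => //= /ord_inj/enum_rank_inj E.
by rewrite E adj_irr in a.
Qed.

Lemma set2_half (d e : V * V) : d \in oedges -> e \in oedges ->
  [set d.1; d.2] = [set e.1; e.2] -> d = e.
Proof.
case: d e => [x y] [z w]; rewrite !inE /= => /andP[_ xy] /andP[_ zw] E.
have /setP/(_ x) := E; have /setP/(_ y) := E; have /setP/(_ z) := E.
rewrite !inE !eqxx !orbT /=.
case: (eqVneq x z) => [xz|xz] /=.
  subst z; case: (eqVneq y w) => [->//|yw]; rewrite orbF => _ /esym/eqP yx.
  by rewrite yx ltnn in xy.
case: (eqVneq z y) => [zy|] //= _ _ /esym/eqP xw.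
by subst z w; have := ltn_trans xy zw; rewrite ltnn.
Qed.

Lemma card_induced_edges X : #|induced_edges adj X| = inner oedges X.
Proof.
have -> : induced_edges adj X =
  [set [set d.1; d.2] | d in [set d in oedges | (d.1 \in X) && (d.2 \in X)]].
  apply/setP => e; rewrite !inE; apply/andP/imsetP.
    case=> /existsP[x /existsP[y /andP[a /eqP ->]]];
      rewrite subUset !sub1set => /andP[xX yX].
    case: (ltngtP (enum_rank x) (enum_rank y)) => [lt|gt|/ord_inj/enum_rank_inj E].
    - by exists (x, y) => //; rewrite !inE a lt xX.
    - by exists (y, x); rewrite 1?setUC // !inE adj_sym a gt xX yX.
    - by rewrite E adj_irr in a.
  case=> [[x y]]; rewrite !inE /= => /andP[/andP[a _] /andP[xX yX]] ->.
  split; last by rewrite subUset !sub1set xX.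
  by apply/existsP; exists x; apply/existsP; exists y; rewrite a /=.
rewrite card_in_imset => [|d e]; last first.
  by rewrite !inE => /andP[dh _] /andP[eh _]; apply: set2_half; rewrite inE.
rewrite -sum1_card /inner big_mkcond [RHS]big_mkcond; apply: eq_bigr => d _; rewrite !inE.
by case: (adj _ _ && _); case: (_ \in X); case: (_ \in X).
Qed.

Lemma card_cut_edges S : #|cut_edges adj S| = boundary S.
Proof.
have -> : cut_edges adj S =
  [set [set d.1; d.2] | d in [set d : V * V | adj d.1 d.2 && ((d.1 \in S) && (d.2 \in
    ~: S))]].
  apply/setP => e; rewrite !inE; apply/existsP/imsetP.
    case=> x /existsP[y /and4P[a xS yS /eqP->]]; exists (x, y) => //.
    by rewrite !inE a xS.
  case=> [[x y]]; rewrite !inE /= => /and3P[a xX yX] ->.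
  by exists x; apply/existsP; exists y; rewrite a xX yX /=.
rewrite card_in_imset => [|[x y] [z w]]; last first.
  rewrite !inE /= => /and3P[_ xS yS] /and3P[_ zS wS] E.
  have /setP/(_ x) := E; have /setP/(_ y) := E; rewrite !inE !eqxx ?orbT.
  have -> : (y == z) = false by apply: contraNF yS => /eqP->.
  have -> : (x == w) = false by apply: contraNF wS => /eqP<-.
  by rewrite /= orbF => /esym/eqP-> /esym/eqP->.
rewrite -sum1_card /boundary /arcs big_mkcond [RHS]big_mkcond; apply: eq_bigr => d _;
  rewrite !inE.
by case: (adj _ _); case: (_ \in S); case: (_ \in S).
Qed.

(** * Three-edge-connectivity of cubic graphs *)

Section Cubic.
Hypothesis adj3 : cubic adj.

Lemma cubic_arcs X : arcs X setT = 3 * #|X|.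
Proof.
rewrite arcsE mulnC -sum_nat_const; apply: eq_bigr => x _.
by rewrite -[RHS](adj3 x); apply: eq_card => y; rewrite !inE.
Qed.

Lemma cubic_boundary X : (inner oedges X).*2 + boundary X = 3 * #|X|.
Proof. by rewrite -cubic_arcs (arcs_split X setT X) setTI setTD arcs_inner. Qed.

Definition edge_connected3 : Prop :=
  forall X, X != set0 -> X != setT -> 3 <= boundary X.

(** The inner ends [Z] of fewer than 3 boundary edges would separate the rest of [X] from its
    complement; if nothing of [X] is left, [X] has at most two vertices and simplicity gives at
    least 3 boundary edges. *)
Lemma three_connected_edge_connected : three_connected adj -> edge_connected3.
Proof.
move=> [V3 conn] X X0 XT; rewrite leqNgt; apply/negP => bX.
pose Z := [set x in X | [exists y, (y \notin X) && adj x y]].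
have bZ : #|Z| <= boundary X.
  rewrite /boundary arcsE -sum1_card big_mkcond [X in _ <= X]big_mkcond;
    apply: leq_sum => x _.
  rewrite inE; case: (x \in X) => //=; case: existsP => // -[y /andP[yX a]].
  by rewrite card_gt0; apply/set0Pn; exists y; rewrite !inE yX.
have [n0 h] := conn Z (leq_ltn_trans bZ bX).
have [/subsetP XZ|/subsetPn[x xX xZ]] := boolP (X \subset Z).
  have : (inner oedges X).*2 <= #|X| * #|X|.-1.
    rewrite -arcs_inner arcsE -sum_nat_const; apply: leq_sum => x xX.
    rewrite (cardsD1 x X) xX /=; apply/subset_leq_card/subsetP => y; rewrite !inE.
    by case/andP=> yX a; rewrite yX andbT; apply: contraTneq a => ->; rewrite adj_irr.
  have := cubic_boundary X; have : #|X| <= 2.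
    by rewrite -ltnS; apply: leq_ltn_trans bX; apply: leq_trans bZ;
      apply/subset_leq_card/subsetP.
  move: X0; rewrite -card_gt0; case: #|X| => [|[|[|]]] //=; lia.
have [y yX] : exists y, y \notin X by apply/existsP; rewrite -negb_forall;
  apply: contraNN XT => /forallP XX; apply/eqP/setP => v; rewrite XX inE.
have yZ : y \in ~: Z by rewrite !inE negb_and yX.
have := h x y; rewrite inE xZ => /(_ isT yZ) /connectP[p].
(* A path that avoids [Z] and starts in [X] never leaves [X]. *)
elim: p x xX {xZ} => [|z p IH] x xX /=; first by move=> _ E; rewrite E xX in yX.
case/andP => /and3P[a xZ zZ]; apply: IH.
apply: contraLR xZ => zX; rewrite !inE negbK xX /=; apply/existsP; exists z;
  by rewrite zX.
Qed.

Hypothesis ec3 : edge_connected3.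

(** A component and the rest of [S] would each have boundary at least 3, and these boundaries add up
    within that of [S]. *)
Lemma connected_of_boundary3 S : S != set0 -> boundary S = 3 -> connected_in adj S.
Proof.
move=> S0 bS; split=> // x y xS yS; apply/negPn/negP => nc.
set e := [rel u v | _] in nc.
pose C := [set z in S | connect e x z].
have xC : x \in C by rewrite inE xS connect0.
have yC : y \in S :\: C by rewrite !inE yS andbT.
have C3 : 3 <= boundary C.
  apply: ec3; first by apply/set0Pn; exists x.
  by apply/eqP => /setP/(_ y); rewrite !inE (negPf nc) andbF.
have D3 : 3 <= boundary (S :\: C).
  apply: ec3; first by apply/set0Pn; exists y.
  by apply/eqP => /setP/(_ x); rewrite !inE xS connect0.
have : boundary C + boundary (S :\: C) <= boundary S; last by lia.
rewrite /boundary /arcs -big_split; apply: leq_sum => -[u v] /= a.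
rewrite !inE.
have := @connect_trans _ e u x v; have := @connect_trans _ e v x u.
have : u \in S -> v \in S -> connect e u v /\ connect e v u.
  by move=> uS vS; split; apply: connect1; rewrite /e /= uS vS ?a // adj_sym a.
case: (u \in S); case: (v \in S) => //=; try by case: (connect e x u);
  case: (connect e x v).
case/(_ isT isT) => -> ->; case: (connect e x u); case: (connect e x v) => //= h1 h2.
  by have := h2 isT isT.
by have := h1 isT isT.
Qed.

Lemma nontrivial_3cut_of_boundary S :
  boundary S = 3 -> 1 < #|S| -> 1 < #|~: S| -> nontrivial_3cut adj S.
Proof.
move=> bS S1 S2; have S0 : S != set0 by rewrite -card_gt0 ltnW.
have C0 : ~: S != set0 by rewrite -card_gt0 ltnW.
(* Removing from [T] a vertex with two outgoing edges would leave boundary at most 3 - 2 + 1. *)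
have matching T : boundary T = 3 -> 1 < #|T| -> ~: T != set0 -> forall x, x \in T ->
  #|[set y in ~: T | adj x y]| <= 1.
  move=> bT T1 T0 x xT; rewrite leqNgt; apply/negP => out.
  have : 3 <= boundary (T :\ x).
    apply: ec3; first by rewrite -card_gt0; have := cardsD1 x T; rewrite xT; lia.
    by apply/eqP => /setP/(_ x); rewrite !inE eqxx.
  have : arcs [set x] (T :\ x) + arcs [set x] (~: T) <= 3.
    rewrite -[X in _ <= X](_ : arcs [set x] setT = 3); last by rewrite cubic_arcs cards1.
    rewrite /arcs -big_split; apply: leq_sum => d _; rewrite !inE.
    by case: (d.1 == x); case: (d.2 \in T); case: (d.2 == x).
  have : boundary (T :\ x) + arcs [set x] (~: T) <= boundary T + arcs (T :\ x) [set x].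
    rewrite /boundary /arcs -!big_split; apply: leq_sum => d _; rewrite !inE /=.
    case: (eqVneq d.1 x) => [->|]; first by rewrite xT; case: (d.2 \in T); case: (_ == _).
    by case: (d.1 \in T); case: (eqVneq d.2 x) => [->|]; rewrite ?xT //;
      case: (d.2 \in T).
  have : 1 < arcs [set x] (~: T) by rewrite arcsE big_set1.
  by rewrite bT (arcsC (T :\ x)); clear; lia.
split; split=> //; first by rewrite card_cut_edges.
- exact: connected_of_boundary3.
- by apply: connected_of_boundary3; rewrite ?boundaryC.
move=> x; have [xS|xS] := boolP (x \in S).
  apply: leq_trans (matching S bS S1 C0 x xS).
  by apply/subset_leq_card/subsetP => y; rewrite !inE => /andP[-> /=]; case: (_ \in S).
have := matching (~: S) _ S2 _ x; rewrite boundaryC setCK inE => /(_ bS S0 xS).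
by apply/leq_trans/subset_leq_card/subsetP => y; rewrite !inE => /andP[-> /=];
  case: (_ \in S).
Qed.

Lemma odd_boundary X : odd (boundary X) = odd #|X|.
Proof. by have := cubic_boundary X; lia. Qed.

Lemma cuts_laminar X S : boundary X = 3 -> boundary S = 3 ->
  [|| X \subset S, X \subset ~: S, S \subset X | ~: S \subset X].
Proof.
move=> bX bS; apply/negPn/negP; rewrite !negb_or => /and4P[nXS nXC nSX nCX].
(* [X] has odd size, so exactly one of [X :&: S] and [X :\: S] is odd; complementing [S] swaps
   them. *)
wlog oI : S bS nXS nXC nSX nCX / odd #|X :&: S|.
  move=> W; have [|eI] := boolP (odd #|X :&: S|); first exact: W.
  apply: (W (~: S)); rewrite ?setCK ?boundaryC // -setDE.
  have := cardsID S X; have := odd_boundary X; rewrite bX; move: eI; clear; lia.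
have [/subsetPn[x xX xS] /subsetPn[y yS yX]] := conj nXS nSX.
(* boundary X = |X| mod 2, so X :\: S and S :\: X would have boundary at least 4,
   against submodularity. *)
have four Y : Y != set0 -> Y != setT -> ~~ odd #|Y| -> 4 <= boundary Y.
  move=> Y0 YT; rewrite -odd_boundary => eY; have := ec3 Y0 YT.
  by rewrite leq_eqVlt => /orP[/eqP E|//]; rewrite -E in eY.
have D1 : 4 <= boundary (X :\: S).
  apply: four; first by apply/set0Pn; exists x; rewrite inE xS.
    by apply/eqP => /setP/(_ y); rewrite !inE yS.
  by have := cardsID S X; have := odd_boundary X; rewrite bX; move: oI; clear; lia.
have D2 : 4 <= boundary (S :\: X).
  apply: four; first by apply/set0Pn; exists y; rewrite inE yX.
    by apply/eqP => /setP/(_ x); rewrite !inE xX.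
  by have := cardsID X S; have := odd_boundary S; rewrite bS setIC; move: oI; clear; lia.
have := boundary_submodular X (~: S);
  rewrite boundaryC bX bS -setDE -[boundary (X :|: _)]boundaryC.
by rewrite setCU setCK setIC -setDE; move: D1 D2; clear; lia.
Qed.

End Cubic.
End Counting.

(** * Three-edge cuts and the canonical decomposition *)

Lemma arcs_imset (T W : finType) (f : T -> W) (r : rel W) (A : {set T}) :
  injective f -> arcs r (f @: A) (f @: A) = arcs (relpre f r) A A.
Proof.
move=> fI; rewrite !arcsE big_imset /=; last by move=> x y _ _; apply: fI.
apply: eq_bigr => x _; rewrite -(card_imset _ fI); apply: eq_card => y.
rewrite !inE; apply/andP/imsetP => [[/imsetP[z zA ->] rz]|[z]].
  by exists z; rewrite ?inE ?zA.
by rewrite inE => /andP[zA rz] ->; rewrite imset_f.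
Qed.

Section Piece.
Variables (G : sgraph) (S : {set vert G}).
Implicit Types X : {set vert G}.
Notation adj := (gadj G).
Notation T := {x : vert G | x \in S}.
Notation padj := (gadj (piece S)).
Hypotheses (adj_sym : symmetric adj) (adj_irr : irreflexive adj).
Hypotheses (adj3 : cubic adj) (ec3 : edge_connected3 adj).
Hypothesis cutS : nontrivial_3cut adj S.

Lemma piece_sym : symmetric padj.
Proof. by case=> [x|] [y|] //=; apply: adj_sym. Qed.

Lemma piece_irr : irreflexive padj.
Proof. by case=> [x|] //=; apply: adj_irr. Qed.

Lemma boundary_cut : boundary adj S = 3.
Proof. by rewrite -card_cut_edges; case: cutS => -[]. Qed.

Lemma card_val_set (P : pred (vert G)) : #|[set t : T | P (val t)]| = #|[set x in S | P
  x]|.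
Proof.
rewrite -(card_imset _ val_inj); apply: eq_card => x; rewrite !inE.
apply/imsetP/andP => [[t]|[xS Px]]; last by exists (Sub x xS); rewrite ?inE.
by rewrite inE => Pt ->; split=> //; apply: (valP t).
Qed.

(** The cut is a matching, so the existential in [piece_adj] merges no two cut edges; this keeps all
    degrees equal to 3. *)
Lemma outside_unique x : x \in S ->
  #|[set y in ~: S | adj x y]| = [exists z, (z \notin S) && adj x z].
Proof.
move=> xS; have [_ [_ _ /(_ x) out]] := cutS.
case: (boolP [exists _, _]) => [/existsP[z /andP[zS xz]] | nz].
  apply/eqP; rewrite eqn_leq card_gt0; apply/andP; split; last first.
    by apply/set0Pn; exists z; rewrite !inE zS.
  apply: leq_trans out; apply/subset_leq_card/subsetP => y; rewrite !inE xS.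
  by case: (y \in S); case: (adj x y).
apply: eq_card0 => y; rewrite !inE; apply/negP => yS; case/existsP: nz; by exists y.
Qed.

Lemma piece_cubic : cubic padj.
Proof.
case=> [t|].
  rewrite (cardsD1 None) inE /= -(outside_unique (valP t)) -(adj3 (val t)).
  rewrite -(cardsID (~: S) [set y | adj (val t) y]); congr (_ + _).
    by apply: eq_card => y; rewrite !inE andbC.
  have -> : [set y | padj (Some t) y] :\ None = Some @: [set s : T | adj (val t) (val s)].
    apply/setP => -[s|]; rewrite !inE /=.
      by rewrite (mem_imset _ _ Some_inj) inE.
    by apply/esym/imsetP => -[].
  rewrite (card_imset _ Some_inj) (card_val_set (adj (val t))).
  by apply: eq_card => y; rewrite !inE negbK.
rewrite -boundary_cut /boundary arcsE (eq_bigr _ outside_unique).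
have -> : [set y | padj None y] = Some @: [set s : T | [exists z,
  (z \notin S) && adj (val s) z]].
  apply/setP => -[s|]; rewrite !inE /=.
    by rewrite (mem_imset _ _ Some_inj) inE.
  by apply/esym/imsetP => -[].
rewrite (card_imset _ Some_inj) (card_val_set (fun x => [exists z,
  (z \notin S) && adj x z])).
rewrite -sum1_card [LHS]big_mkcond [RHS]big_mkcond; apply: eq_bigr => x _; rewrite inE.
by case: (x \in S); case: [exists _, _].
Qed.

(** [None] stands for the shrunk side [~: S]: [b] is false for sets inside [S] and true for sets
    containing [~: S]. *)
Definition lift b (X : {set vert G}) : {set vert (piece S)} :=
  [set u : option T | if u is Some t then val t \in X else b].

Lemma lift_false X : lift false X = Some @: [set t : T | val t \in X].
Proof.
apply/setP => -[t|]; rewrite !inE; first by rewrite (mem_imset _ _ Some_inj) inE.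
by apply/esym/imsetP => -[].
Qed.

Lemma liftC b X : ~: lift b X = lift (~~ b) (~: X).
Proof. by apply/setP => -[t|]; rewrite !inE. Qed.

Lemma card_lift X : X \subset S -> #|lift false X| = #|X|.
Proof.
move=> /setIidPr XS; rewrite lift_false (card_imset _ Some_inj) (card_val_set (mem X)).
by apply: eq_card => x; rewrite -[in RHS]XS !inE.
Qed.

(** Both graphs are cubic, so equal size and equal inner edges give equal boundary by the degree
    count. *)
Lemma boundary_lift X : X \subset S -> boundary padj (lift false X) = boundary adj X.
Proof.
move=> XS; have := cubic_boundary piece_sym piece_irr piece_cubic (lift false X).
have := cubic_boundary adj_sym adj_irr adj3 X; rewrite (card_lift XS) => <-.
rewrite -(arcs_inner piece_sym piece_irr) -(arcs_inner adj_sym adj_irr).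
have -> : arcs padj (lift false X) (lift false X) = arcs adj X X; last by lia.
have EX : X = val @: [set t : T | val t \in X].
  apply/setP => x; apply/idP/imsetP => [xX|[t + ->]]; last by rewrite inE.
  by exists (Sub x (subsetP XS x xX)); rewrite ?inE.
by rewrite lift_false (arcs_imset _ _ Some_inj) [in RHS]EX (arcs_imset _ _ val_inj).
Qed.

Lemma boundary_lift_true X : ~: X \subset S ->
  boundary padj (lift true X) = boundary adj X.
Proof.
move=> XS; rewrite -(boundaryC piece_sym) liftC (boundary_lift XS).
exact: boundaryC.
Qed.

Lemma card_piece : #|vert (piece S)| = #|S|.+1.
Proof. by rewrite card_option card_sig. Qed.

Lemma card_lift_true X : ~: X \subset S -> (#|lift true X| + #|~: S| = #|X| + 1)%N.
Proof.
move=> XS; have := cardsC (lift true X); rewrite liftC (card_lift XS) card_piece.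
by have := cardsC S; have := cardsC X; lia.
Qed.

Lemma piece_edge_connected : edge_connected3 padj.
Proof.
move=> Y; wlog nY : Y / None \notin Y.
  move=> W Y0 YT; have [NY|] := boolP (None \in Y); last by move/W; apply.
  rewrite -(boundaryC piece_sym); apply: W; rewrite ?inE ?NY //.
    by apply: contraNneq YT => /(congr1 (@setC _)); rewrite setCK setC0 => /eqP.
  by apply: contraNneq Y0 => /(congr1 (@setC _)); rewrite setCK setCT => /eqP.
move=> Y0 _; pose X := val @: [set t : T | Some t \in Y].
have XS : X \subset S by apply/subsetP => _ /imsetP[t _ ->]; apply: (valP t).
have EY : Y = lift false X.
  apply/setP => -[t|]; rewrite !inE; last by apply: negbTE.
  by rewrite (mem_imset _ _ val_inj) inE.
rewrite EY boundary_lift //; apply: ec3.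
  by rewrite -card_gt0 -card_lift // -EY card_gt0.
apply: contraTneq XS => ->; rewrite subTset; apply/eqP => E.
by have [[_ _]] := cutS; rewrite E setCT cards0.
Qed.

End Piece.

Arguments lift {G S} b X.

(** Shrinking the complement of such a set to a vertex leaves an order divisible by 4, which for a
    connected cubic graph means odd cycle rank. *)
Definition odd_cut (V : finType) (adj : rel V) (X : {set V}) : Prop :=
  boundary adj X = 3 /\ #|X| %% 4 = 3.

Lemma card_edges_cubic (V : finType) (adj : rel V) :
  symmetric adj -> irreflexive adj -> cubic adj ->
  2 * #|edges adj| = 3 * #|V|.
Proof.
move=> s i c; have -> : edges adj = induced_edges adj setT.
  by apply/setP => e; rewrite [RHS]inE subsetT andbT.
rewrite card_induced_edges //; have := cubic_boundary s i c setT.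
by rewrite -(boundaryC s) setCT /boundary arcsE big_set0 cardsT; lia.
Qed.

(** Two pieces of orders n1 and n2 come from order n1 + n2 - 2, which carries the residue mod 4
    along. By laminarity an odd cut lifts to a piece; it stays odd, since a side whose piece has no
    odd factor has size 1 mod 4 and can be shrunk. *)
Lemma canon_odd_cuts G F :
    canon_decomp G F -> symmetric (gadj G) -> irreflexive (gadj G) ->
    cubic (gadj G) -> edge_connected3 (gadj G) -> count cyclically_odd F <= 1 ->
  [/\ #|vert G| %% 4 = (if count cyclically_odd F == 0 then 2 else 0),
      count cyclically_odd F = 0 -> forall X, ~ odd_cut (gadj G) X
    & forall X Y, odd_cut (gadj G) X -> odd_cut (gadj G) Y -> X :&: Y != set0].
Proof.
elim=> {G F} [G noc|G S F1 F2 cutS _ IH1 _ IH2] s i c ec.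
  (* The cycle rank of a connected cubic graph on n vertices is n/2 + 1. *)
  have N4 : odd (beta G) = (#|vert G| %% 4 == 0).
    by have := card_edges_cubic s i c; rewrite /beta cardsT /=; lia.
  have even : ~~ odd #|vert G| by have := card_edges_cubic s i c => /=; lia.
  (* In a factor only trivial cuts remain, so an odd cut omits one vertex; two such sets meet. *)
  have big X : odd_cut (gadj G) X -> #|X|.+1 = #|vert G| /\ 3 <= #|X|.
    case=> bX X3; have := cardsC X; have [C1|C1] := leqP #|~: X| 1.
      by move: even => /=; lia.
    by case: (noc X); apply: nontrivial_3cut_of_boundary => //; lia.
  rewrite /= addn0 /cyclically_odd N4 => _.
  split=> [||X Y /big[X1 X3] /big[Y1 Y3]].
  - by move: even => /=; case: eqP => /=; lia.
  - move=> N0 X oX; have [X1 _] := big X oX; case: oX => _; rewrite /= -X1 in N0 *.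
    by move: N0; case: eqP => //=; lia.
  - by rewrite -card_gt0; move: X1 Y1 (cardsUI X Y) (subset_leq_card (subsetT (X :|:
    Y))); rewrite cardsT /=; lia.
rewrite count_cat => F01.
have bS := boundary_cut cutS.
have cutC : nontrivial_3cut (gadj G) (~: S).
  case: cutS => -[c3 S1 S2] [cS1 cS2 m]; split; split; rewrite ?setCK //.
    by rewrite card_cut_edges (boundaryC s).
  move=> x; apply: leq_trans (m x); apply/subset_leq_card/subsetP => y; rewrite !inE.
  by case: (x \in S); case: (y \in S).
have [n1 e1 d1] := IH1 (piece_sym s) (piece_irr i) (piece_cubic c cutS)
  (piece_edge_connected s i c ec cutS) (leq_trans (leq_addr _ _) F01).
have [n2 e2 d2] := IH2 (piece_sym s) (piece_irr i) (piece_cubic c cutC)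
  (piece_edge_connected s i c ec cutC) (leq_trans (leq_addl _ _) F01).
have cS := cardsC S.
have cP1 := card_piece S; have cP2 := card_piece (~: S).
have inS (X : {set vert G}) : X \subset S -> odd_cut (gadj G) X ->
  odd_cut (gadj (piece S)) (lift false X).
  by move=> XS; rewrite /odd_cut (boundary_lift s i c) // card_lift.
have inC (X : {set vert G}) : X \subset ~: S -> odd_cut (gadj G) X ->
  odd_cut (gadj (piece (~: S))) (lift false X).
  by move=> XS; rewrite /odd_cut (boundary_lift s i c) // card_lift.
have overC (X : {set vert G}) : ~: S \subset X -> count cyclically_odd F2 = 0 ->
  odd_cut (gadj G) X ->
    odd_cut (gadj (piece S)) (lift true X).
  move=> XS c0 [bX X3]; have XS' : ~: X \subset S by rewrite -[S]setCK setCS.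
  split; first by rewrite (boundary_lift_true s i c).
  by move: n2 (card_lift_true XS'); rewrite c0 cP2 /=; clear -X3; lia.
have overS (X : {set vert G}) : S \subset X -> count cyclically_odd F1 = 0 ->
  odd_cut (gadj G) X ->
    odd_cut (gadj (piece (~: S))) (lift true X).
  move=> XS c0 [bX X3]; have XS' : ~: X \subset ~: S by rewrite setCS.
  split; first by rewrite (boundary_lift_true s i c).
  by move: n1 (card_lift_true XS'); rewrite setCK c0 cP1 /=; clear -X3; lia.
have lam (X : {set vert G}) : odd_cut (gadj G) X ->
  [|| X \subset S, X \subset ~: S, S \subset X | ~: S \subset X].
  by case=> bX _; apply: cuts_laminar.
split.
- move: n1 n2 cS; rewrite cP1 cP2 /=; case: eqP => c1; case: eqP => c2;
  case: eqP => c12; move: F01 c1 c2 c12; clear; lia.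
- move=> c0 X oX; have [c1 c2] : count cyclically_odd F1 = 0 /\ count cyclically_odd F2
  = 0 by lia.
  case/or4P: (lam X oX) => sX.
  - exact: e1 c1 _ (inS _ sX oX).
  - exact: e2 c2 _ (inC _ sX oX).
  - exact: e2 c2 _ (overS _ sX c1 oX).
  - exact: e1 c1 _ (overC _ sX c2 oX).
have liftI (U : {set vert G}) (b b' : bool) (X Y : {set vert G}) :
    X :&: Y = set0 -> ~~ (b && b') -> lift (S := U) b X :&: lift b' Y = set0.
  move=> XY bb; apply/setP => -[t|]; rewrite !inE; last exact: negbTE.
  by have := XY => /setP/(_ (val t)); rewrite !inE.
(* [U] is the side whose piece may carry the odd factor, so [~: U] contains no odd cut. Disjoint odd
   cuts then lift to disjoint odd cuts of that piece, as at most one of them contains [~: U]. *)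
have pair (U : {set vert G}) : U != setT ->
    (forall X : {set vert G}, X \subset U -> odd_cut (gadj G) X ->
      odd_cut (gadj (piece U)) (lift false X)) ->
    (forall X : {set vert G}, ~: U \subset X -> odd_cut (gadj G) X ->
      odd_cut (gadj (piece U)) (lift true X)) ->
    (forall X, odd_cut (gadj G) X -> [|| X \subset U, X \subset ~: U,
      U \subset X | ~: U \subset X]) ->
    (forall X : {set vert G}, X \subset ~: U -> ~ odd_cut (gadj G) X) ->
    (forall X Y, odd_cut (gadj (piece U)) X -> odd_cut (gadj (piece U)) Y ->
      X :&: Y != set0) ->
  forall X Y, odd_cut (gadj G) X -> odd_cut (gadj G) Y -> X :&: Y != set0.
  move=> UT inU overU lamU noC dU X Y oX oY; apply/eqP => XY.
  have side (A B : {set vert G}) : odd_cut (gadj G) A -> odd_cut (gadj G) B ->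
    A :&: B = set0 ->
      A \subset U \/ ~: U \subset A.
    move=> oA oB /eqP; rewrite setI_eq0 disjoints_subset => AB.
    case/or4P: (lamU A oA) => sA; [by left | by case: (noC A) | | by right].
    case: (noC B) => //; apply: subset_trans (_ : ~: A \subset _); last by rewrite setCS.
    by rewrite -[B]setCK setCS.
  have YX : Y :&: X = set0 by rewrite setIC.
  case: (side X Y oX oY XY) => sX; case: (side Y X oY oX YX) => sY.
  - by have := dU _ _ (inU _ sX oX) (inU _ sY oY); rewrite liftI ?eqxx.
  - by have := dU _ _ (inU _ sX oX) (overU _ sY oY); rewrite liftI ?eqxx.
  - by have := dU _ _ (overU _ sX oX) (inU _ sY oY); rewrite liftI ?eqxx.
  - have : ~: U \subset X :&: Y by rewrite subsetI sX.
    rewrite XY subset0 => /eqP/(congr1 (@setC _)); rewrite setCK setC0 => UE.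
    by rewrite UE eqxx in UT.
have [c1|c1] := eqVneq (count cyclically_odd F1) 0.
  apply: (pair (~: S)) => //.
  - apply/eqP => /(congr1 (@setC _)); rewrite setCK setCT => S0.
    by have [[_ S1 _] _] := cutS; rewrite S0 cards0 in S1.
  - by move=> X; rewrite setCK => sX; apply: overS.
  - by move=> X /lam; rewrite setCK; do 4!case: (_ \subset _).
  - by move=> X; rewrite setCK => sX oX; apply: (e1 c1 _ (inS _ sX oX)).
have c2 : count cyclically_odd F2 = 0 by lia.
apply: (pair S) => //.
- by apply/eqP => ST; have [[_ _ S2] _] := cutS; rewrite ST setCT cards0 in S2.
- by move=> X sX; apply: overC.
- by move=> X sX oX; apply: (e2 c2 _ (inC _ sX oX)).
Qed.

(** * The decycling partition *)

Section Decycling.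
Variables (V : finType) (adj : rel V).
Hypotheses (adj_sym : symmetric adj) (adj_irr : irreflexive adj).
Hypotheses (adj3 : cubic adj) (ec3 : edge_connected3 adj).
Implicit Types (X Y R A : {set V}) (P : {set {set V}}).
Notation e := (inner (oedges adj)).

(** Predecessor and successor are two distinct neighbours of each vertex of [s]. *)
Lemma cycle_inner (s : seq V) : uniq s -> 3 <= size s -> cycle adj s ->
  #|s| <= e [set x in s].
Proof.
move=> us s3 cs; set X := [set x in s].
suff : \sum_(x in X) 2 <= arcs adj X X.
  by rewrite sum_nat_const arcs_inner // muln2 leq_double cardsE.
rewrite arcsE; apply: leq_sum => x; rewrite inE => xs.
have [i s' rs] := rot_to xs.
have {}cs : cycle adj (x :: s') by rewrite -rs rot_cycle.
have {}us : uniq (x :: s') by rewrite -rs rot_uniq.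
have {}s3 : 3 <= size (x :: s') by rewrite -rs size_rot.
have mX y : y \in s' -> y \in X by move=> ys; rewrite inE -(mem_rot i) rs inE ys orbT.
case: s' {rs} cs us s3 mX => [|y p] //; case/lastP: p => [|p z] //.
rewrite /= rcons_path last_rcons => /andP[xy /andP[_ zx]] /and3P[_ yp _] _ mX.
have yz : y != z by apply: contraNneq yp => ->; rewrite mem_rcons mem_head.
rewrite -[2]/(1.+1) -(_ : #|[set y; z]| = 2); last by rewrite cards2 yz.
apply/subset_leq_card/subsetP => w; rewrite !inE => /orP[] /eqP ->.
  by rewrite xy; have := mX y; rewrite !inE eqxx => ->.
by rewrite adj_sym zx; have := mX z; rewrite !inE mem_rcons mem_head orbT => ->.
Qed.

(** A cycle would span as many edges as vertices; two separated pieces, each sparse, would leave at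
    most [#|A|] - 2 edges. *)
Lemma tree_of_inner A : A != set0 ->
    (forall X, X != set0 -> X \subset A -> e X < #|X|) -> #|A| <= (e A).+1 ->
  tree_in adj A.
Proof.
move=> A0 sparse eA; split; last first.
  move=> s us s3 sA; apply/negP => cs.
  have := cycle_inner us s3 cs; rewrite leqNgt => /negP; apply.
  rewrite -[X in _ < X]cardsE; apply: sparse.
    by rewrite -card_gt0 cardsE (card_uniqP us) (ltn_trans _ s3).
  by apply/subsetP => x; rewrite inE => /sA.
split=> // x y xA yA; apply/negPn/negP => nc.
set r := [rel u v | _] in nc.
pose C := [set z in A | connect r x z].
have C0 : C != set0 by apply/set0Pn; exists x; rewrite inE xA connect0.
have D0 : A :\: C != set0 by apply/set0Pn; exists y; rewrite !inE yA andbT.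
have sC : C \subset A by apply/subsetP => z; rewrite inE => /andP[].
have := sparse _ C0 sC; have := sparse _ D0 (subsetDl _ _).
have := cardsID C A; rewrite (setIidPr sC).
suff : e A <= e C + e (A :\: C) by move: eA; clear; lia.
rewrite /inner -big_split; apply: leq_sum => -[u v] /=.
rewrite !inE /= => /andP[a _].
have := @connect_trans _ r u x v; have := @connect_trans _ r v x u.
have : u \in A -> v \in A -> connect r u v /\ connect r v u.
  by move=> uS vS; split; apply: connect1; rewrite /r /= uS vS ?a // adj_sym a.
case: (u \in A); case: (v \in A) => //=.
case/(_ isT isT) => -> ->; case: (connect r x u); case: (connect r x v) => //= h1 h2.
  by have := h2 isT isT.
by have := h1 isT isT.
Qed.

Definition odd_cutb X : bool := (boundary adj X == 3) && (#|X| %% 4 == 3).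

(** Twice the edge count is [3 * #|X|] minus the boundary. Only boundary 3 with the correction term
    present breaks the bound 3|X|/2, and then [#|X|] is 3 mod 4. *)
Lemma need_odd_cut X : X != set0 -> X != setT ->
  2 * need (oedges adj) (fun=> 1) X <= 3 * #|X| + odd_cutb X.
Proof.
move=> X0 XT; have := ec3 X0 XT; have := cubic_boundary adj_sym adj_irr adj3 X.
rewrite /need /odd_cutb sum1_card; move: (e X) #|X| (boundary adj X) => a n b.
clear; case: (boolP (odd _)); lia.
Qed.

Lemma sum_need_odd_cut P R : R != set0 -> partition P (~: R) ->
  2 * \sum_(X in P) need (oedges adj) (fun=> 1) X <= 3 * #|~: R| + \sum_(X in P)
    odd_cutb X.
Proof.
move=> R0 pP; rewrite (card_partition pP) !big_distrr -big_split /=.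
apply: leq_sum => X XP; apply: need_odd_cut; first exact: partition_neq0 pP XP.
apply: contraNneq R0 => XT; have := partitionS pP XP.
by rewrite XT subTset => /eqP/(congr1 (@setC _)); rewrite setCK setCT => ->.
Qed.

(** Weights are odd, so those outside [A] are at least 3. The total weight then bounds the edges
    inside [~: A] by those inside [R]; as [R] lies in [~: A], equality holds and [A] has [#|A|] - 1
    edges. *)
Lemma tree_of_parity_vector R m : R != set0 -> ~: R != set0 ->
    parity_vector (oedges adj) (fun=> 1) (~: R) m ->
  exists A, tree_in adj A /\ e (~: A) = e R.
Proof.
move=> R0 U0 [m1 m2 m3]; pose A := [set v in ~: R | m v == 1].
have sAU : A \subset ~: R by apply/subsetP => v; rewrite inE => /andP[].
have sRJ : R \subset ~: A by rewrite -[R]setCK setCS.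
have sparse X : X != set0 -> X \subset A -> e X < #|X|.
  move=> X0 XA; apply: leq_trans (m2 X X0 (subset_trans XA sAU)) _.
  rewrite -sum1_card; apply: leq_sum => v /(subsetP XA).
  by rewrite inE => /andP[_ /eqP->].
have mA : #|A| + 3 * #|~: R :\: A| <= (e (~: R)).+1.
  rewrite -m3 (big_setID A) /= (setIidPr sAU) mulnC -sum_nat_const -sum1_card.
  apply: leq_add; apply: leq_sum => v; first by rewrite inE => /andP[_ /eqP->].
  rewrite inE => /andP[vA vU]; have := m1 v vU; move: vA; rewrite inE vU /=.
  by case: (m v) => [|[|[|]]].
have b3 : 3 <= boundary adj R.
  by apply: ec3 => //; apply: contraNneq U0 => ->; rewrite setCT.
have := cubic_boundary adj_sym adj_irr adj3 A.
have := cubic_boundary adj_sym adj_irr adj3 (~: A); rewrite (boundaryC adj_sym) => cJ cA.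
have := cubic_boundary adj_sym adj_irr adj3 R.
have := cubic_boundary adj_sym adj_irr adj3 (~: R); rewrite (boundaryC adj_sym) => cU cR.
have eRJ := inner_sub (oedges adj) sRJ.
have c1 := cardsID A (~: R); rewrite (setIidPr sAU) in c1.
have c2 := cardsC A; have c3 := cardsC R.
have A0 : A != set0.
  by rewrite -card_gt0; move: mA c1 cU b3; clear; lia.
have eA := sparse A A0 (subxx A).
exists A; split; last by move: cJ cA cU cR eRJ c1 c2 c3 eA mA; clear; lia.
apply: tree_of_inner => //.
by move: cJ cA cU cR eRJ c1 c2 c3 eA mA; clear; lia.
Qed.

End Decycling.

(** * Removing a vertex or an edge *)

Theorem theorem15 (V : finType) (adj : rel V)
    (adj_sym : symmetric adj) (adj_irr : irreflexive adj)
    (Hcubic : cubic adj) (H3 : three_connected adj)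
    (F : seq sgraph) (HF : canon_decomp (SGraph adj) F)
    (Hodd : count cyclically_odd F <= 1) :
  exists A : {set V}, coherent_decycling_partition adj A.
Proof.
have ec3 := three_connected_edge_connected adj_sym adj_irr Hcubic H3.
have [/= V4 noodd meetodd] := canon_odd_cuts HF adj_sym adj_irr Hcubic ec3 Hodd.
have [V3 _] := H3.
have bound1 (P : {set {set V}}) U : partition P U -> \sum_(X in P) odd_cutb adj X <= 1.
  move=> pP; have -> : \sum_(X in P) odd_cutb adj X = #|[set X in P | odd_cutb adj X]|.
    rewrite -sum1_card big_mkcond [RHS]big_mkcond; apply: eq_bigr => X _; rewrite inE.
    by case: (X \in P); case: odd_cutb.
  rewrite leqNgt; apply/negP => /card_gt1P[X [Y []]]; rewrite !inE.
  case/andP=> XP /andP[/eqP bX /eqP oX] /andP[YP /andP[/eqP bY /eqP oY]] XY.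
  have := trivIsetP (partition_trivIset pP) X Y XP YP XY; rewrite -setI_eq0.
  by apply/negP/meetodd.
have cb := cubic_boundary adj_sym adj_irr Hcubic.
have cC (R : {set V}) : #|R| <= 2 -> ~: R != set0.
  by move=> R2; rewrite -card_gt0; have := cardsC R; lia.
have [v _] : exists v, v \in V by apply/card_gt0P; apply: leq_ltn_trans V3.
have [c0|c1] := eqVneq (count cyclically_odd F) 0.
  pose R := [set v]; have cR : #|R| = 1 by rewrite cards1.
  have R0 : R != set0 by rewrite -card_gt0 cR.
  have U0 : ~: R != set0 by apply: cC; rewrite cR.
  have bR : 3 <= boundary adj R.
    by apply: ec3 => //; apply: contraNneq U0 => ->; rewrite setCT.
  (* With [boundary adj R] = 3, the bound 3|U|/2 for U = [~: R] is e(U) + 3/2, and integrality gives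
     e(U) + 1. *)
  have [P pP|m pm] := parity_vector_exists (D := oedges adj) (p := fun=> 1) U0.
    have := sum_need_odd_cut adj_sym adj_irr Hcubic ec3 R0 pP.
    rewrite [X in _ + X]big1 => [|X _]; last first.
      apply/eqP; rewrite eqb0; apply/negP => /andP[/eqP bX /eqP oX].
      exact: noodd c0 X (conj bX oX).
    move: (cb (~: R)) (cb R); rewrite (boundaryC adj_sym) cR; clear; lia.
  have [A [tA eA]] := tree_of_parity_vector adj_sym adj_irr Hcubic ec3 R0 U0 pm.
  exists A; split=> //; left; apply/eqP;
    rewrite /independent -cards_eq0 card_induced_edges // eA.
  by move: (cb R); rewrite cR; move: bR; clear; lia.
have [w] : exists w, w \in [set w | adj v w] by apply/card_gt0P; rewrite Hcubic.
rewrite inE => vw; pose R := [set v; w].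
have nvw : v != w by apply: contraTneq vw => ->; rewrite adj_irr.
have cR : #|R| = 2 by rewrite cards2 nvw.
have R0 : R != set0 by rewrite -card_gt0 cR.
have U0 : ~: R != set0 by apply: cC; rewrite cR.
have bR : 3 <= boundary adj R.
  by apply: ec3 => //; apply: contraNneq U0 => ->; rewrite setCT.
have eR : inner (oedges adj) R = 1.
  have : 0 < inner (oedges adj) R.
    rewrite -card_induced_edges // card_gt0; apply/set0Pn; exists R;
      rewrite !inE subxx andbT.
    by apply/existsP; exists v; apply/existsP; exists w; rewrite vw /=.
  by move: (cb R) bR; rewrite cR; clear; lia.
(* Now [boundary adj R] = 4, and one odd cut allows a sum up to e(U) + 2 for U = [~: R]. Since 4
   divides [#|V|], e(U) is odd while the sum of needs is even, so the sum is at most e(U) + 1. *)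
have [P pP|m pm] := parity_vector_exists (D := oedges adj) (p := fun=> 1) U0.
  have := sum_need_odd_cut adj_sym adj_irr Hcubic ec3 R0 pP; have := bound1 P _ pP.
  have := sum_need_odd (oedges adj) (fun=> 1) pP; rewrite sum1_card.
  move: (cb (~: R)) (cb R) (cardsC R); rewrite (boundaryC adj_sym) cR eR.
  by move: V4; rewrite (negPf c1) /=; clear; lia.
have [A [tA eA]] := tree_of_parity_vector adj_sym adj_irr Hcubic ec3 R0 U0 pm.
by exists A; split=> //; right; rewrite /near_independent card_induced_edges // eA.
Qed.
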